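(* Let $\mathbb{K}$ be a field of characteristic zero, let $r\geq 3$ be an integer, and for $\sigma\in\mathbb{K}[z]_{\leq r}$ write $\sigma(z)=a_0+a_1z+\cdots+a_rz^r$. Set $$\Delta_2(\sigma)=2r\,a_ra_{r-2}-(r-1)a_{r-1}^2,$$ $$\Delta_3(\sigma)=3r^2a_r^2a_{r-3}-3r(r-2)a_ra_{r-1}a_{r-2}+(r-1)(r-2)a_{r-1}^3.$$ Then $U_r=\{\sigma\in\mathbb{K}[z]_{\leq r} : a_r\,\Delta_2(\sigma)\,\Delta_3(\sigma)\neq 0\}$ is a nonempty Zariski open subset of $\mathbb{K}[z]_{\leq r}$ such that, for every $\sigma\in U_r$ and every pair of distinct nonconstant polynomials $p,q\in\mathbb{K}[t]$, the polynomials $\sigma(p)$ and $\sigma(q)$ are linearly independent over $\mathbb{K}$.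
   Context: $\mathbb{K}[z]_{\leq r}$ denotes the $\mathbb{K}$-vector space of univariate polynomials of degree at most $r$, identified with the affine space $\mathbb{K}^{r+1}$ of coefficients with its Zariski topology. $\sigma(p)$ denotes the composition $\sigma(p(t))\in\mathbb{K}[t]$. *)

(* Defs.v *)
From mathcomp Require Import all_boot all_order all_algebra.
From mathcomp Require Import mpoly.
Set Implicit Arguments.
Unset Strict Implicit.
Unset Printing Implicit Defensive.
Import GRing.Theory.
Local Open Scope ring_scope.

(* The family S of equations may be infinite. *)
Definition zariski_closed (K : fieldType) (n : nat) (Z : 'rV[K]_n -> Prop) :
    Prop :=
  exists S : {mpoly K[n]} -> Prop,
    forall v : 'rV[K]_n, Z v <-> (forall f, S f -> f.@[fun i => v 0 i] = 0).

Definition zariski_open (K : fieldType) (n : nat) (U : 'rV[K]_n -> Prop) :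
    Prop :=
  zariski_closed (fun v => ~ U v).

(* [{poly_n K}] consists of the polynomials of size at most n, that is of
   degree at most n - 1; [rVnpoly] maps a row vector to the polynomial whose
   coefficients are its entries. *)
Definition zariski_open_npoly (K : fieldType) (n : nat)
    (U : {poly_n K} -> Prop) : Prop :=
  zariski_open (fun v : 'rV[K]_n => U (rVnpoly v)).

Definition Delta2 (K : fieldType) (r : nat) (s : {poly K}) : K :=
  2%:R * r%:R * s`_r * s`_(r - 2) - (r%:R - 1) * s`_(r - 1) ^+ 2.

Definition Delta3 (K : fieldType) (r : nat) (s : {poly K}) : K :=
  3%:R * r%:R ^+ 2 * s`_r ^+ 2 * s`_(r - 3)
  - 3%:R * r%:R * (r%:R - 2%:R) * s`_r * s`_(r - 1) * s`_(r - 2)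
  + (r%:R - 1) * (r%:R - 2%:R) * s`_(r - 1) ^+ 3.

Definition Ur (K : fieldType) (r : nat) (s : {poly_(r.+1) K}) : Prop :=
  s`_r * Delta2 r s * Delta3 r s != 0.

Definition nonconstant (K : fieldType) (p : {poly K}) : Prop :=
  (1 < size p)%N.

Definition lin_indep2 (K : fieldType) (V : lmodType K) (u v : V) : Prop :=
  forall a b : K, a *: u + b *: v = 0 -> a = 0 /\ b = 0.

(* Main.v *)
Require Import Defs.
From mathcomp Require Import all_boot all_order all_algebra.
From mathcomp Require Import mpoly.
From mathcomp Require Import ring.
Set Implicit Arguments.
Unset Strict Implicit.
Unset Printing Implicit Defensive.
Import GRing.Theory.
Local Open Scope ring_scope.

(** The complement of U_r is the zero set of the single polynomial
    a_r Delta_2 Delta_3, which in characteristic zero is nonzero at a polynomial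
    with a_(r-1) = 0 and the other coefficients equal to 1.

    For the independence, the point is that s(p) = c s(q) with c nonzero forces
    p = q; a dependence between s(p) and s(q) with a zero coefficient is
    excluded because s(p) and s(q) are nonzero.

    Translating the variable by h = a_(r-1) / (r a_r) turns s into a polynomial
    S whose coefficient of degree r - 1 vanishes, and then Delta_2 and Delta_3
    are, up to nonzero factors, the coefficients of S in degrees r - 2 and
    r - 3 ([depressed_coefs]). Replacing p, q by P = p + h, Q = q + h, the
    relation becomes S(P) = c S(Q). Comparing degrees and leading coefficients,
    P and Q have the same degree d, and c = w^r for w the ratio of their leading
    coefficients. As S has no term of degree r - 1, the difference
    P^r - (w Q)^r has degree at most (r - 2) d. But it is P - w Q times a
    factor of degree exactly (r - 1) d, so P = w Q ([eq_of_exp_close]). Hence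
    S(w Q) = c S(Q), and so S(w X) = c S(X): w^k = c for every exponent k that
    occurs in S. Since r - 2 and r - 3 both occur, w = 1 and P = Q
    ([comp_depressed_inj]). *)

(** * Translation of the variable of a polynomial *)

Lemma coefXaddC_exp (R : comNzRingType) (c : R) (i k : nat) :
  (('X + c%:P) ^+ i)`_k = c ^+ (i - k) *+ 'C(i, k).
Proof.
elim: i k => [|i IHi] [|k]; rewrite ?expr0 ?coefC ?bin0n ?mulr0n //.
  by rewrite exprS mulrDl coefD coefXM coefCM IHi add0r !subn0 !bin0 exprS.
rewrite exprS mulrDl coefD coefXM coefCM !IHi /= subSS binS mulrnDr addrC.
congr (_ + _); have [lt_ki | le_ik] := ltnP k i.
  by rewrite mulrnAr -exprS subnSK.
by rewrite bin_small // !mulr0n mulr0.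
Qed.

Lemma coef_comp_polyXaddC (R : comNzRingType) (p : {poly R}) (c : R) (k : nat) :
  (p \Po ('X + c%:P))`_k
    = \sum_(j < size p - k) p`_(k + j) * c ^+ j * 'C(k + j, k)%:R.
Proof.
rewrite coef_comp_poly.
under eq_bigr do rewrite coefXaddC_exp.
have [le_kp | /ltnW lt_pk] := leqP k (size p); last first.
  rewrite (eqP lt_pk) big_ord0 big1 // => i _.
  by rewrite bin_small ?mulr0 // (leq_trans (ltn_ord i)).
rewrite -(big_mkord predT (fun i => p`_i * (c ^+ (i - k) *+ 'C(i, k)))).
rewrite (big_cat_nat (leq0n k) le_kp) /= big1_seq ?add0r; last first.
  move=> i; rewrite mem_index_iota => /andP[_ lt_ik].
  by rewrite bin_small ?mulr0.
rewrite -{1}[k]add0n big_addn big_mkord; apply: eq_bigr => i _.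
by rewrite addnK addnC -[_ *+ 'C(_, _)]mulr_natr mulrA.
Qed.

(** * Rigidity of compositions with a depressed polynomial *)

(** In the factorization of P^(n+2) - Q^(n+2) by P - Q, the cofactor has degree
    (n + 1) d, where d > 0 is the degree of P: a nonzero difference would
    therefore have degree at least (n + 1) d > n d. *)
Lemma eq_of_exp_close (K : fieldType) (charK : [pchar K] =i pred0)
    (n : nat) (P Q : {poly K}) :
    (1 < size P)%N -> size P = size Q -> lead_coef P = lead_coef Q ->
    (size (P ^+ n.+2 - Q ^+ n.+2)%R <= (n * (size P).-1).+1)%N ->
  P = Q.
Proof.
move=> szP szPQ lcPQ; set d := (size P).-1; rewrite subrXX.
set S := \sum_(_ < _) _.
move=> szle; apply/eqP; rewrite -subr_eq0; apply: contraLR szle => PQ0.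
have P0 : P != 0 by rewrite -size_poly_gt0 ltnW.
have Q0 : Q != 0 by rewrite -size_poly_gt0 -szPQ size_poly_gt0.
(* The n + 2 summands of the cofactor S all have degree (n + 1) d and the same
   leading coefficient; in characteristic zero that coefficient survives in
   the sum. *)
have coefS : S`_(n.+1 * d) = lead_coef P ^+ n.+1 *+ n.+2.
  rewrite coef_sum (eq_bigr (fun=> lead_coef P ^+ n.+1)) ?sumr_const ?card_ord //.
  move=> i _ /=; have le_in : (i <= n.+1)%N by rewrite -ltnS.
  have -> : lead_coef P ^+ n.+1 = lead_coef (P ^+ (n.+1 - i) * Q ^+ i).
    by rewrite lead_coefM !lead_coef_exp -lcPQ -exprD subnK.
  rewrite lead_coefE; congr (_ `_ _).
  rewrite size_mul ?expf_neq0 // -(prednK (_ : 0 < size (P ^+ _))%N); last first.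
    by rewrite size_poly_gt0 expf_neq0.
  rewrite -(prednK (_ : 0 < size (Q ^+ _))%N); last first.
    by rewrite size_poly_gt0 expf_neq0.
  by rewrite !size_exp -szPQ addnS addSn /= -mulnDr subnK // mulnC.
have coefS0 : S`_(n.+1 * d) != 0.
  rewrite coefS -mulr_natr mulf_neq0 ?expf_neq0 ?lead_coef_eq0 //.
  by move/pcharf0P: charK ->.
have szS : (n.+1 * d < size S)%N.
  by rewrite ltnNge; apply: contra coefS0 => /leq_sizeP/(_ _ (leqnn _)) ->.
have S0 : S != 0 by rewrite -size_poly_gt0 (leq_trans _ szS).
have PQgt0 : (0 < size (P - Q)%R)%N by rewrite size_poly_gt0.
rewrite size_mul // -ltnNge -(prednK PQgt0) addSn /=.
apply: leq_trans (leq_addl _ _); apply: leq_trans szS.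
by rewrite !ltnS mulSn -[X in (X < _)%N]add0n ltn_add2r /d -subn1 subn_gt0.
Qed.

(** Here r = n + 3; the vanishing coefficient gives P = w Q, and the two nonzero
    ones give w = 1. *)
Lemma comp_depressed_inj (K : fieldType) (charK : [pchar K] =i pred0)
    (n : nat) (S P Q : {poly K}) (c : K) :
    size S = n.+4 -> S`_n.+2 = 0 -> S`_n.+1 != 0 -> S`_n != 0 -> c != 0 ->
    (1 < size P)%N -> (1 < size Q)%N -> S \Po P = c *: (S \Po Q) ->
  P = Q.
Proof.
move=> szS S2 S1 S0 c0 szP szQ eqPQ.
have a0 : S`_n.+3 != 0.
  by rewrite -[n.+3]/(n.+4.-1) -szS -lead_coefE lead_coef_eq0 -size_poly_gt0 szS.
have P0 : P != 0 by rewrite -size_poly_gt0 ltnW.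
have Q0 : Q != 0 by rewrite -size_poly_gt0 ltnW.
have szPQ : size P = size Q.
  have := congr1 (fun p : {poly K} => (size p).-1) eqPQ.
  rewrite size_scale // !size_comp_poly szS /= => /eqP.
  rewrite eqn_pmul2l // => /eqP.
  by case: (size P) szP => // m _; case: (size Q) szQ => // m' _ /= ->.
(* Comparing leading coefficients provides an r-th root of c inside K. *)
pose w := lead_coef P / lead_coef Q.
have w0 : w != 0 by rewrite mulf_neq0 ?invr_eq0 ?lead_coef_eq0.
have cw : c = w ^+ n.+3.
  have := congr1 lead_coef eqPQ.
  rewrite lead_coefZ !lead_coef_comp // szS /= lead_coefE szS /= => eqlc.
  rewrite expr_div_n; apply: (mulIf (expf_neq0 n.+3 (_ : lead_coef Q != 0))).
    by rewrite lead_coef_eq0.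
  rewrite divfK ?expf_neq0 ?lead_coef_eq0 //.
  by apply: (mulfI a0); rewrite eqlc mulrCA.
have PwQ : P = w *: Q.
  apply: (@eq_of_exp_close K charK n.+1) => //.
  - by rewrite size_scale.
  - by rewrite lead_coefZ divfK ?lead_coef_eq0.
  (* S = a X^r + T with deg T <= r - 2, so a (P^r - (w Q)^r) is a combination
     of T(P) and T(Q), of degree at most (r - 2) deg P. *)
  pose T := take_poly n.+2 S.
  have defS : S = S`_n.+3 *: 'X^(n.+3) + T.
    apply/polyP=> i; rewrite coefD coefZ coefXn coef_take_poly.
    case: (ltngtP i n.+3) => [lt_i3|gt_i3|->].
    - rewrite mulr0 add0r; case: (ltngtP i n.+2) => [_ //|gt_i2|->//].
      by move: lt_i3; rewrite ltnS leqNgt gt_i2.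
    - rewrite mulr0 add0r nth_default ?szS //.
      by rewrite ltnNge (leq_trans _ (ltnW gt_i3)).
    by rewrite mulr1 ltnNge leqnSn addr0.
  have szT (R : {poly K}) :
      size R = size P -> (size (T \Po R) <= (n.+1 * (size P).-1).+1)%N.
    move=> szR; apply: leq_trans (size_comp_poly_leq _ _) _.
    rewrite szR ltnS leq_mul //.
    by case: (size T) (size_take_poly n.+2 S).
  have -> : P ^+ n.+3 - (w *: Q) ^+ n.+3
            = (S`_n.+3)^-1 *: (c *: (T \Po Q) - (T \Po P)).
    apply: (scalerI a0); rewrite scalerA divff // scale1r.
    move: eqPQ; rewrite {1 2}defS !comp_polyD !comp_polyZ !comp_Xn_poly.
    rewrite scalerDr => /(canRL (addrK _)) eqPQ.
    rewrite scalerBr eqPQ exprZn -cw !scalerA [_ * c]mulrC.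
    ring.
  apply: leq_trans (size_scale_leq _ _) _.
  apply: leq_trans (size_polyD _ _) _; rewrite geq_max size_polyN.
  by rewrite (leq_trans (size_scale_leq _ _)) !szT.
(* S(w Q) = c S(Q), and Q, being nonconstant, is transcendental over K. *)
have Seq : S \Po (w *: 'X) = c *: S.
  apply/eqP; rewrite -subr_eq0 -(comp_poly_eq0 _ szQ) comp_polyB -comp_polyA.
  by rewrite !comp_polyZ comp_polyX -PwQ eqPQ subrr.
have coefw k : S`_k != 0 -> w ^+ k = c.
  move=> Sk0; have := congr1 (fun p : {poly K} => p`_k) Seq.
  rewrite coefZ coef_comp_poly.
  under eq_bigr do rewrite exprZn coefZ coefXn.
  have lt_kS : (k < size S)%N.
    by rewrite ltnNge; apply: contra Sk0 => le_Sk; rewrite nth_default.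
  rewrite (bigD1 (Ordinal lt_kS)) //= eqxx mulr1 big1 ?addr0.
    by rewrite mulrC => /(mulIf Sk0).
  move=> i; rewrite -val_eqE /= eq_sym => /negbTE ->.
  by rewrite !mulr0.
(* The coefficients r - 2 and r - 3 have consecutive indices: w^(n+1) = w^n. *)
have w1 : w = 1.
  apply: (mulIf (expf_neq0 n w0)).
  by rewrite -exprS mul1r !coefw.
by rewrite PwQ w1 scale1r.
Qed.

(** * Delta_2 and Delta_3 as coefficients of the depressed polynomial *)

Lemma two_mul_bin2 (R : comNzRingType) n :
  2%:R * ('C(n.+2, n))%:R = n.+2%:R * n.+1%:R :> R.
Proof.
have <- : 'C(n.+2, 2) = 'C(n.+2, n) by rewrite -bin_sub // subSS subn1.
by rewrite -!natrM -mul_bin_diag bin1.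
Qed.

Lemma six_mul_bin3 (R : comNzRingType) n :
  6%:R * ('C(n.+3, n))%:R = n.+3%:R * n.+2%:R * n.+1%:R :> R.
Proof.
have <- : 'C(n.+3, 3) = 'C(n.+3, n) by rewrite -bin_sub // !subSS subn0.
rewrite -mulrA -two_mul_bin2.
have <- : 'C(n.+2, 2) = 'C(n.+2, n) by rewrite -bin_sub // !subSS subn0.
by rewrite -!natrM mulnCA mul_bin_diag mulnA.
Qed.

(** This is where the formulas for Delta_2 and Delta_3 come from: they are the
    coefficients of the depressed polynomial, with denominators cleared. *)
Lemma depressed_coefs (K : fieldType) (charK : [pchar K] =i pred0)
    (n : nat) (s : {poly K}) :
    size s = n.+4 ->
    let a := s`_n.+3 in let r : K := n.+3%:R in
    let S := s \Po ('X - (s`_n.+2 / (r * a))%:P) in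
  [/\ S`_n.+2 = 0, 2%:R * r * a * S`_n.+1 = Delta2 n.+3 s
    & 3%:R * r ^+ 2 * a ^+ 2 * S`_n = Delta3 n.+3 s].
Proof.
move=> szs a r S.
have a0 : a != 0.
  rewrite /a -[n.+3]/(n.+4.-1) -szs -lead_coefE lead_coef_eq0.
  by rewrite -size_poly_gt0 szs.
have natK m : m.+1%:R != 0 :> K by move/pcharf0P: charK ->.
have r0 : r != 0 by apply: natK.
have two0 : 2%:R != 0 :> K by apply: natK.
have six0 : 6%:R != 0 :> K by apply: natK.
have r1 : n.+2%:R = r - 1 :> K by rewrite /r -[n.+3]addn1 natrD addrK.
have r2 : n.+1%:R = r - 2%:R :> K by rewrite /r -[n.+3]addn2 natrD addrK.
have B2 : 'C(n.+2, n)%:R = (r - 1) * (r - 2%:R) / 2%:R :> K.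
  by rewrite -r1 -r2 -two_mul_bin2 mulrAC divff ?mul1r.
have B2' : 'C(n.+3, n.+1)%:R = r * (r - 1) / 2%:R :> K.
  by rewrite -r1 -two_mul_bin2 mulrAC divff ?mul1r.
have B3 : 'C(n.+3, n)%:R = r * (r - 1) * (r - 2%:R) / 6%:R :> K.
  by rewrite -r1 -r2 -six_mul_bin3 mulrAC divff ?mul1r.
have := coef_comp_polyXaddC s (- (s`_n.+2 / (r * a))).
rewrite polyCN -/S => coefS.
rewrite /Delta2 /Delta3 !coefS szs -/r.
have -> : (n.+4 - n.+2 = 2)%N by rewrite !subSS -addn2 addKn.
have -> : (n.+4 - n.+1 = 3)%N by rewrite !subSS -addn3 addKn.
have -> : (n.+4 - n = 4)%N by rewrite -addn4 addKn.
rewrite !big_ord_recl !big_ord0.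
rewrite /= !subSS !subn0 /bump /= !addn0 !add1n !addnS !addn0 !binn !binSn.
rewrite B2 B2' B3 -!/a -/r r1 r2.
clearbody a r.
split.
- by field; rewrite a0 r0.
- by field; rewrite two0 a0 r0.
- move: (s`_n.+2) (s`_n.+1) (s`_n) => x y z.
  by field; rewrite six0 a0 r0 two0.
Qed.

Lemma comp_scale_inj (K : fieldType) (charK : [pchar K] =i pred0)
    (n : nat) (s p q : {poly K}) (c : K) :
    size s = n.+4 -> Delta2 n.+3 s != 0 -> Delta3 n.+3 s != 0 -> c != 0 ->
    (1 < size p)%N -> (1 < size q)%N -> s \Po p = c *: (s \Po q) ->
  p = q.
Proof.
move=> szs D2 D3 c0 szp szq eqpq.
have [] := depressed_coefs charK szs.
set h := _ / _; set S := s \Po _ => S2 eqD2 eqD3.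
have shiftK (u : {poly K}) : S \Po (u + h%:P) = s \Po u.
  rewrite /S -comp_polyA comp_polyB comp_polyX comp_polyC.
  by rewrite addrK.
have szshift (u : {poly K}) : (1 < size u)%N -> (1 < size (u + h%:P)%R)%N.
  by move=> szu; rewrite size_polyDl // (leq_ltn_trans (size_polyC_leq1 _)).
apply: (addIr h%:P).
apply: (@comp_depressed_inj K charK n S _ _ c); rewrite ?shiftK ?szshift //.
- by rewrite size_comp_poly2 // size_XsubC.
- by apply: contraNneq D2 => S1; rewrite -eqD2 S1 mulr0.
- by apply: contraNneq D3 => S0; rewrite -eqD3 S0 mulr0.
Qed.

(** * The set U_r *)

Lemma Ur_open (K : fieldType) (r : nat) :
  (3 <= r)%N -> zariski_open_npoly (@Ur K r).
Proof.
move=> hr.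
pose x k : {mpoly K[r.+1]} := 'X_(inord k).
pose D2 : {mpoly K[r.+1]} :=
  2%:R * r%:R * x r * x (r - 2)%N - (r%:R - 1) * x (r - 1)%N ^+ 2.
pose D3 : {mpoly K[r.+1]} :=
  3%:R * r%:R ^+ 2 * x r ^+ 2 * x (r - 3)%N
  - 3%:R * r%:R * (r%:R - 2%:R) * x r * x (r - 1)%N * x (r - 2)%N
  + (r%:R - 1) * (r%:R - 2%:R) * x (r - 1)%N ^+ 3.
exists (fun f => f = x r * D2 * D3) => v.
set s := rVnpoly v.
have evalx k : (k <= r)%N -> (x k).@[fun i => v 0 i] = s`_k.
  by move=> le_kr; rewrite mevalXU -[v in LHS]rVnpolyK mxE inordK.
have evalD : (x r * D2 * D3).@[fun i => v 0 i] = s`_r * Delta2 r s * Delta3 r s.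
  rewrite /D2 /D3 /Delta2 /Delta3.
  rewrite !(rmorphM, rmorphD, rmorphB, rmorphXn, rmorph_nat, rmorph1, rmorphN) /=.
  by rewrite !evalx ?leq_subr.
rewrite /Ur; split=> [/negP/negPn/eqP Ds f -> | /(_ _ erefl)].
  by rewrite evalD.
by rewrite evalD => ->; rewrite eqxx.
Qed.

Lemma Ur_nonempty (K : fieldType) (charK : [pchar K] =i pred0) (n : nat) :
  exists s : {poly_(n.+4) K}, Ur (r := n.+3) s.
Proof.
have natK m : m.+1%:R != 0 :> K by move/pcharf0P: charK ->.
(* a_(r-1) = 0 and a_i = 1 otherwise, so Delta_2 = 2 r and Delta_3 = 3 r^2. *)
pose s := mk_npoly n.+4 (fun i => (i != n.+2)%:R : K).
have coefs k : (k < n.+4)%N -> s`_k = (k != n.+2)%:R.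
  by move=> lt_kn; rewrite coef_poly lt_kn.
have s3 : s`_n.+3 = 1 by rewrite coefs // gtn_eqF.
have s2 : s`_n.+2 = 0 by rewrite coefs // eqxx.
have s1 : s`_n.+1 = 1 by rewrite coefs ?ltn_eqF // ltnW.
have s0 : s`_n = 1 by rewrite coefs ?ltn_eqF // -addn4 -addn1 leq_add2l.
exists s; rewrite /Ur /Delta2 /Delta3 !subSS !subn0 s3 s2 s1 s0.
rewrite !expr0n !expr1n /= !(mulr0, mul0r, mulr1, mul1r, subr0, addr0).
by rewrite !mulf_neq0 ?natK.
Qed.

Theorem proposition2p1 (K : fieldType) (charK : [pchar K] =i pred0)
    (r : nat) (hr : (3 <= r)%N) :
  [/\ (exists s : {poly_(r.+1) K}, Ur s),
      zariski_open_npoly (@Ur K r)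
    & forall s : {poly_(r.+1) K}, Ur s ->
      forall p q : {poly K}, nonconstant p -> nonconstant q -> p <> q ->
        lin_indep2 (s \Po p) (s \Po q)].
Proof.
split; last 1 first.
- case: r hr => [|[|[|n]]] // _ s; rewrite /Ur mulf_eq0 mulf_eq0 !negb_or.
  case/andP=> /andP[a0 D2] D3 p q szp szq neq_pq a b.
  have szs : size s = n.+4.
    apply/eqP; rewrite eqn_leq size_npoly ltnNge.
    by apply: contra a0 => les; rewrite nth_default.
  have comp0 (u : {poly K}) (k : K) :
      nonconstant u -> k *: (s \Po u) = 0 -> k = 0.
    move=> szu /eqP; rewrite scaler_eq0 => /orP[/eqP-> //|].
    by rewrite comp_poly_eq0 // -size_poly_eq0 szs.
  have [->|b0] := eqVneq b 0; first by rewrite scale0r addr0 => /(comp0 _ _ szp).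
  have [->|a0'] := eqVneq a 0; first by rewrite scale0r add0r => /(comp0 _ _ szq).
  move/eqP; rewrite addr_eq0 => /eqP eqab; case: neq_pq.
  apply: (@comp_scale_inj K charK n s p q (- (a^-1 * b))) => //.
    by rewrite oppr_eq0 mulf_neq0 ?invr_eq0.
  by apply: (scalerI a0'); rewrite eqab scalerA mulrN mulVKf // scaleNr.
- by case: r hr => [|[|[|n]]] // _; apply: Ur_nonempty.
- exact: Ur_open.
Qed.
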